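(* Let $F$ be the CNF encoding of an unsatisfiable system of $m$ linear equations over a finite field. There is a Cutting Planes refutation of $F$ of size $|F|^{O(\log m)}$.
   Context: A system of linear equations over $\mathbb{F}_q$ has width $d$ if each equation has at most $d$ variables with nonzero coefficient. Each $\mathbb{F}_q$-valued variable is encoded by Boolean variables, and each width-$d$ equation is encoded by $q^{d-1}$ width-$d$ clauses, one ruling out each falsifying assignment; $|F|:=mq^{d-1}$ denotes the size of the resulting CNF. The CNF is translated into linear inequalities in the standard way ($0\le x_i\le1$, and for each clause $\bigvee_{i\in P}x_i\vee\bigvee_{i\in N}\neg x_i$ the inequality $\sum_{i\in P}x_i+\sum_{i\in N}(1-x_i)\ge1$). Cutting Planes: a proof is a sequence of integer linear inequalities, each from the system or derived from earlier ones by nonnegative integer linear combination of two earlier inequalities or by division (from $ax\le b$ with a positive integer $d$ dividing all entries of $a$, deduce $(a/d)x\le\lfloor b/d\rfloor$); a refutation derives $0\ge1$; size = number of lines.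
   Formalization: The constant in O(log m) is absolute for width d ≥ 2, but for d ≤ 1 it may depend on the field: with |F| = mq^{d-1}, the system {x=0, x=1} over F_q has |F| = 2 yet needs more than q lines. Clauses saying each variable takes exactly one value are included. *)

(* Defs.v *)
From HB Require Import structures.
From mathcomp Require Import all_boot all_order all_algebra.

Set Implicit Arguments.
Unset Strict Implicit.
Unset Printing Implicit Defensive.

Import Order.TTheory GRing.Theory Num.Theory.
Local Open Scope ring_scope.

(* [(v, true)] is the literal v and [(v, false)] is its negation. *)
Definition literal (V : Type) : Type := (V * bool)%type.

Definition negl (V : Type) (l : literal V) : literal V := (l.1, ~~ l.2).

Definition holds (V : Type) (w : V -> bool) (l : literal V) : bool :=
  w l.1 == l.2.

(* [(a, b)] is the integer inequality a x <= b; an inequality a x >= b is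
   represented as (-a) x <= -b. *)
Definition ineq (V : finType) : Type := ({ffun V -> int} * int)%type.

Definition upper_bound (V : finType) (v : V) : ineq V :=
  ([ffun u => (u == v)%:Z], 1).

Definition lower_bound (V : finType) (v : V) : ineq V :=
  ([ffun u => - (u == v)%:Z], 0).

(* sum_(v in P) v + sum_(v in N) (1 - v) >= 1, where P and N are the sets of
   variables occurring positively and negatively in C, is put in the form
   sum_(v in N) v - sum_(v in P) v <= #|N| - 1. *)
Definition clause_ineq (V : finType) (C : {set literal V}) : ineq V :=
  ([ffun v => ((v, false) \in C)%:Z - ((v, true) \in C)%:Z],
   #|[set v | (v, false) \in C]|%:Z - 1).

Definition cnf_ineq (V : finType) (Phi : {set {set literal V}}) (l : ineq V) :
    Prop :=
  [\/ exists2 C, C \in Phi & l = clause_ineq C,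
      exists v, l = upper_bound v
    | exists v, l = lower_bound v].

Definition cp_step (V : finType) (hyp : ineq V -> Prop) (prev : seq (ineq V))
    (l : ineq V) : Prop :=
  [\/ hyp l,
      exists l1 l2 (s t : nat),
        [/\ l1 \in prev, l2 \in prev & l = l1 *+ s + l2 *+ t]
    | exists l1 (k : nat),
        [/\ l1 \in prev, (0 < k)%N, forall v, (k%:Z %| l1.1 v)%Z
          & l = ([ffun v => (l1.1 v %/ k%:Z)%Z], (l1.2 %/ k%:Z)%Z)]].

Definition cp_proof (V : finType) (hyp : ineq V -> Prop) (pf : seq (ineq V)) :
    Prop :=
  forall i, (i < size pf)%N -> cp_step hyp (take i pf) (nth 0 pf i).

(* [(0, -1)] is 0 <= -1, that is, 0 >= 1. *)
Definition cp_refutation (V : finType) (hyp : ineq V -> Prop)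
    (pf : seq (ineq V)) : Prop :=
  cp_proof hyp pf /\ (0, -1) \in pf.

Definition unsatisfiable (F : finFieldType) (m n : nat) (A : 'M[F]_(m, n))
    (b : 'cV[F]_m) : Prop :=
  ~ exists x : 'cV[F]_n, A *m x = b.

Definition support (F : finFieldType) (m n : nat) (A : 'M[F]_(m, n))
    (i : 'I_m) : {set 'I_n} :=
  [set j | A i j != 0].

Definition has_width (F : finFieldType) (m n : nat) (A : 'M[F]_(m, n))
    (d : nat) : Prop :=
  forall i, (#|support A i| <= d)%N.

(* An F-valued variable is encoded by a block of Boolean variables indexed by
   B.  For an equation in d variables to become a set of clauses of width d,
   "x = a" has to be expressed by a single literal [lit a] of the block; every
   value has to be representable.  See the two instances below: one Boolean
   variable per element of F, or, over F_2, a single Boolean variable. *)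
Definition value_encoding (F : finFieldType) (B : finType)
    (lit : F -> literal B) : Prop :=
  forall a, exists w : B -> bool, forall a', holds w (lit a') = (a' == a).

Section Encoding.

Variables (F : finFieldType) (B : finType) (lit : F -> literal B).

Definition value_lit (n : nat) (j : 'I_n) (a : F) : literal ('I_n * B)%type :=
  ((j, (lit a).1), (lit a).2).

(* Only the values of x on the support of equation i matter here. *)
Definition forbid (m n : nat) (A : 'M[F]_(m, n)) (i : 'I_m) (x : 'cV[F]_n) :
    {set literal ('I_n * B)%type} :=
  [set negl (value_lit j (x j 0)) | j in support A i].

Definition equation_clauses (m n : nat) (A : 'M[F]_(m, n)) (b : 'cV[F]_m)
    (i : 'I_m) : {set {set literal ('I_n * B)%type}} :=
  [set forbid A i x | x : 'cV[F]_n & (A *m x) i 0 != b i 0].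

(* The j-th variable takes at least one value, and at most one value.  For the
   one-bit encoding over F_2 these clauses are tautologies. *)
Definition block_clauses (n : nat) (j : 'I_n) :
    {set {set literal ('I_n * B)%type}} :=
  [set value_lit j a | a : F] |:
  [set [set negl (value_lit j u.1); negl (value_lit j u.2)]
     | u : F * F & u.1 != u.2].

Definition cnf (m n : nat) (A : 'M[F]_(m, n)) (b : 'cV[F]_m) :
    {set {set literal ('I_n * B)%type}} :=
  (\bigcup_i equation_clauses A b i) :|: (\bigcup_j block_clauses j).

End Encoding.

(* For #|F| > 2 an equation in d variables has (#|F| - 1) * #|F| ^ d.-1
   falsifying assignments; the conventional size omits the factor #|F| - 1 and
   the block clauses. *)
Definition cnf_size (F : finFieldType) (m d : nat) : nat :=
  (m * #|F| ^ d.-1)%N.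

Lemma value_encoding_unary (F : finFieldType) :
  value_encoding (fun a : F => (a, true)).
Proof. by move=> a; exists (pred1 a) => a'; rewrite /holds /= eqb_id. Qed.

Lemma value_encoding_bit : value_encoding (fun a : 'F_2 => (tt, a == 1)).
Proof.
move=> a; exists (fun=> a == 1) => a'; rewrite /holds /=.
by case: a a' => [[|[|[]]] ?] // [[|[|[]]] ?].
Qed.

(* Main.v *)
(** An unsatisfiable system Ax = b over F has a combination y of its rows with
    yA = 0 and yb != 0, and an additive map F -> F_p, with residues
    g : F -> [0, p), can be chosen with g (yb) != 0.  For a set S of equations
    let f_S be the sum over the variables j of g (a_j x_j), where a is the
    S-part of the combination; over the literals [x_j = u] this is a linear
    form with nonnegative integer coefficients, and every x satisfying S gives
    f_S the residue g of the S-part of yb mod p.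
    Suppose that f_S is known to be a constant k with the wrong residue.  Split
    S into halves S1 and S2 and branch over all the (polynomially many) values
    k1 and k2 of f_S1 and f_S2.  Either one of them has the wrong residue, and
    the argument recurses, or p does not divide k1 + k2 - k although
    f_S1 + f_S2 - f_S is p times an integral form, which one division refutes.
    For a single equation, branch over the values of its at most d variables.
    Starting from f = 0 for the whole system, the recursion has depth
    O(log m).  Branching over the value of a form with a known lower bound only
    ever restricts to faces, where Cutting Planes proofs can be lifted with
    constant overhead. *)

Require Import Defs.
From HB Require Import structures.
From mathcomp Require Import all_boot all_order all_algebra all_field.
From mathcomp Require Import zify.

Set Implicit Arguments.
Unset Strict Implicit.
Unset Printing Implicit Defensive.

Import Order.TTheory GRing.Theory Num.Theory.
Local Open Scope ring_scope.

(** * Cutting Planes derivations and branching rules *)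

Section CuttingPlanes.

Variable V : finType.
Implicit Types (H : ineq V -> Prop) (f g h l : ineq V) (pf : seq (ineq V)).

(* An inequality (a, b) is identified with the affine form b - a x, which it
   asserts to be nonnegative. *)
Definition one_form : ineq V := (0, 1).

Definition add_hyp H f : ineq V -> Prop := fun l => H l \/ l = f.

Definition derives H (s : nat) f : Prop :=
  exists pf, [/\ cp_proof H pf, (size pf <= s)%N & f \in pf].

Definition refutes H s : Prop := derives H s (- one_form).

Lemma cp_step_mono H H' pf pf' l :
  (forall h, H h -> H' h) -> {subset pf <= pf'} ->
  cp_step H pf l -> cp_step H' pf' l.
Proof.
move=> sH spf [/sH Hl|[l1 [l2 [s [t [/spf l1P /spf l2P ->]]]]]|].
- exact: Or31.
- by apply: Or32; exists l1, l2, s, t.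
by move=> [l1 [k [/spf l1P k0 dv ->]]]; apply: Or33; exists l1, k.
Qed.

Lemma cp_proof_nil H : cp_proof H [::].
Proof. by []. Qed.

Lemma cp_proof_rcons H pf l :
  cp_proof H (rcons pf l) <-> cp_proof H pf /\ cp_step H pf l.
Proof.
split=> [pfP|[pfP lP] i].
  split=> [i ltis|]; last first.
    have := pfP (size pf); rewrite size_rcons ltnSn => /(_ isT).
    by rewrite nth_rcons ltnn eqxx -cats1 take_size_cat.
  have := pfP i; rewrite size_rcons ltnS ltnW // => /(_ isT).
  by rewrite nth_rcons ltis -cats1 takel_cat // ltnW.
rewrite size_rcons ltnS leq_eqVlt => /orP [/eqP->|ltis].
  by rewrite nth_rcons ltnn eqxx -cats1 take_size_cat.
by rewrite nth_rcons ltis -cats1 takel_cat ?(ltnW ltis) //; apply: pfP.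
Qed.

Lemma cp_proof_cut H f pf1 pf2 :
  cp_proof H pf1 -> f \in pf1 -> cp_proof (add_hyp H f) pf2 ->
  cp_proof H (pf1 ++ pf2).
Proof.
move=> pf1P fpf1; elim/last_ind: pf2 => [|pf2 l IH]; first by rewrite cats0.
rewrite -rcons_cat !cp_proof_rcons => -[pf2P lP]; split; first exact: IH.
have sub2 : {subset pf2 <= pf1 ++ pf2} by move=> x; rewrite mem_cat orbC => ->.
case: lP => [[Hl|->]|C|D].
- exact: Or31.
(* Here [f] is a line of [pf1] and no longer a hypothesis; citing it as 1 f + 0 f keeps the length
   of [pf2]. *)
- apply: Or32; exists f, f, 1%N, 0%N.
  by rewrite mem_cat fpf1 mulr1n mulr0n addr0.
- exact: (cp_step_mono (fun h Hh => Hh) sub2 (Or32 _ _ C)).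
exact: (cp_step_mono (fun h Hh => Hh) sub2 (Or33 _ _ D)).
Qed.

Lemma cp_proof_mono H H' pf :
  (forall h, H h -> H' h) -> cp_proof H pf -> cp_proof H' pf.
Proof. by move=> sH pfP i /pfP; apply: cp_step_mono. Qed.

Lemma derives_mono H H' s s' f :
  (forall h, H h -> H' h) -> (s <= s')%N -> derives H s f -> derives H' s' f.
Proof.
move=> sH les [pf [pfP szpf fpf]]; exists pf; split=> //.
  exact: cp_proof_mono pfP.
exact: leq_trans les.
Qed.

Lemma derives_leq H s s' f : (s <= s')%N -> derives H s f -> derives H s' f.
Proof. exact: derives_mono. Qed.

Lemma derives_step H s f g :
  derives H s f -> (forall pf, f \in pf -> cp_step H pf g) ->
  derives H s.+1 g.
Proof.
move=> [pf [pfP szpf fpf]] gP; exists (rcons pf g).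
split; last by rewrite mem_rcons mem_head.
  by apply/cp_proof_rcons; split=> //; apply: gP.
by rewrite size_rcons.
Qed.

Lemma derives_cut H s t f g :
  derives H s f -> derives (add_hyp H f) t g -> derives H (s + t) g.
Proof.
move=> [pf1 [pf1P sz1 fpf1]] [pf2 [pf2P sz2 gpf2]]; exists (pf1 ++ pf2).
split; first exact: cp_proof_cut pf2P.
  by rewrite size_cat leq_add.
by rewrite mem_cat gpf2 orbT.
Qed.

Lemma derives_hyp H f : H f -> derives H 1 f.
Proof.
move=> Hf; exists [:: f]; split; rewrite ?mem_head // -[[:: f]]/(rcons [::] f).
by apply/cp_proof_rcons; split; [exact: cp_proof_nil | apply: Or31].
Qed.

Lemma derives_comb H s t f g (c : nat) :
  derives H s f -> derives H t g -> derives H (s + t).+1 (f + g *+ c).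
Proof.
move=> [pf1 [pf1P sz1 fpf1]] [pf2 [pf2P sz2 gpf2]].
exists (rcons (pf1 ++ pf2) (f + g *+ c)).
split; last by rewrite mem_rcons mem_head.
  apply/cp_proof_rcons; split.
    by apply: (cp_proof_cut pf1P fpf1); apply: cp_proof_mono pf2P; left.
  apply: Or32; exists f, g, 1%N, c.
  by rewrite !mem_cat fpf1 gpf2 orbT mulr1n.
by rewrite size_rcons size_cat ltnS leq_add.
Qed.

Lemma derives_add H s t f g :
  derives H s f -> derives H t g -> derives H (s + t).+1 (f + g).
Proof. by move=> fP gP; rewrite -[g]mulr1n; apply: derives_comb. Qed.

(** The combination rule needs earlier lines, so some hypothesis is cited before 0 is formed from
    it. *)
Lemma derives_zero H f : H f -> derives H 2 0.
Proof.
move=> /derives_hyp /derives_step; apply=> pf fpf.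
by apply: Or32; exists f, f, 0%N, 0%N; rewrite !mulr0n addr0.
Qed.

Lemma derives_sum H s t f (I : eqType) (r : seq I) (c : I -> nat)
    (h : I -> ineq V) :
  derives H s f -> (forall i, i \in r -> derives H t (h i)) ->
  derives H (s + size r * t.+1) (f + \sum_(i <- r) h i *+ c i).
Proof.
move=> fP; elim: r => [|i r IH] hP; first by rewrite big_nil addr0 addn0.
rewrite big_cons addrCA addrC /= mulSn addnCA addnC -addSnnS addSn.
apply: derives_comb; last by apply: hP; rewrite mem_head.
by apply: IH => j jr; apply: hP; rewrite inE jr orbT.
Qed.

Lemma fst_mulrn f k : (f *+ k).1 = f.1 *+ k.
Proof. by elim: k => // k IH; rewrite !mulrS -IH. Qed.

Lemma snd_mulrn f k : (f *+ k).2 = f.2 *+ k.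
Proof. by elim: k => // k IH; rewrite !mulrS -IH. Qed.

Lemma one_form_mulrz (r : int) : one_form *~ r = (0, r).
Proof.
have oneM k : one_form *+ k = (0, k%:Z).
  by apply/pair_eqP; rewrite /= fst_mulrn snd_mulrn mul0rn pmulrn intz !eqxx.
case: r => k; first by rewrite -pmulrn oneM.
rewrite NegzE mulrNz -pmulrn oneM.
by apply/pair_eqP; rewrite /= oppr0 !eqxx.
Qed.

(** On affine forms, division only rounds the constant: floor((k c + r) / k) = c + floor(r / k). *)
Lemma derives_div H s f (k : nat) (r : int) : (0 < k)%N ->
  derives H s (f *+ k + one_form *~ r) ->
  derives H s.+1 (f + one_form *~ (r %/ k)%Z).
Proof.
move=> k0 /derives_step; apply=> pf lpf.
apply: Or33; exists (f *+ k + one_form *~ r), k; split=> // [v|].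
  rewrite one_form_mulrz /= addr0 fst_mulrn ffunMnE -mulr_natr natz.
  exact: dvdz_mull.
apply/pair_eqP; rewrite !one_form_mulrz /= !addr0 fst_mulrn snd_mulrn.
apply/andP; split; apply/eqP.
  apply/ffunP => v; rewrite ffunE /= ffunMnE -mulr_natr natz mulzK //.
  by lia.
by rewrite -mulr_natr natz divzMDl //; lia.
Qed.

Lemma refutes_neg H s (r : int) :
  r < 0 -> derives H s (one_form *~ r) -> refutes H s.+1.
Proof.
case: r => // k _ rP; rewrite /refutes.
have := @derives_div H s 0 k.+1 (Negz k) isT.
rewrite mul0rn !add0r NegzE => /(_ _).
have -> : (- k.+1%:Z %/ k.+1)%Z = - 1.
  by rewrite -[X in (X %/ _)%Z]mulN1r mulzK.
by rewrite mulrN1z; apply; rewrite -NegzE.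
Qed.

(* Cook-Coullard-Turan: every line l derived on the face f = 0 of f >= 0 lifts
   to l + K f without the hypothesis f <= 0, for K large enough; before a
   division by k the multiple K is raised to k K, at the cost of one line. *)
Lemma cp_proof_face H f pf : H f -> cp_proof (add_hyp H (- f)) pf ->
  exists pf', [/\ cp_proof H pf', (size pf' <= (size pf).*2.+1)%N, f \in pf'
    & forall l, l \in pf -> exists K : nat, l + f *+ K \in pf'].
Proof.
move=> Hf; elim/last_ind: pf => [|pf l IH].
  move=> _; have [pf' [P1 P2 P3]] := derives_hyp Hf.
  by exists pf'; split.
rewrite cp_proof_rcons => -[/IH [pf' [pfP szpf fpf liftP]] lP].
have single K : cp_step H pf' (l + f *+ K) ->
    exists pf', [/\ cp_proof H pf', (size pf' <= (size (rcons pf l)).*2.+1)%N,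
      f \in pf' & forall l', l' \in rcons pf l ->
        exists K : nat, l' + f *+ K \in pf'].
  move=> stepP; exists (rcons pf' (l + f *+ K)).
  split; first exact/cp_proof_rcons.
  - by rewrite !size_rcons doubleS ltnS (leq_trans szpf).
  - by rewrite mem_rcons inE fpf orbT.
  move=> l'; rewrite mem_rcons inE => /orP[/eqP->|].
    by exists K; rewrite mem_rcons mem_head.
  by move=> /liftP [K' K'P]; exists K'; rewrite mem_rcons inE K'P orbT.
case: lP => [[Hl|lE]|[l1 [l2 [s [t [/liftP [K1 l1P] /liftP [K2 l2P] lE]]]]]|].
- by apply: (single 0%N); apply: Or31; rewrite addr0.
- apply: (single 1%N); apply: Or32; exists f, f, 0%N, 0%N.
  by rewrite lE !mulr0n addr0 mulr1n addNr.
- apply: (single (K1 * s + K2 * t)%N); apply: Or32.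
  exists (l1 + f *+ K1), (l2 + f *+ K2), s, t; split=> //.
  by rewrite lE !mulrnDl mulrnDr !mulrnA addrACA.
move=> [l1 [k [/liftP [K l1P] k0 dv lE]]].
pose l2 := l1 + f *+ (K * k).
have l2E : l2 = (l1 + f *+ K) *+ 1 + f *+ (K * k.-1).
  by rewrite mulr1n -addrA -mulrnDr -mulnS prednK.
have pf2P : cp_proof H (rcons pf' l2).
  apply/cp_proof_rcons; split=> //; apply: Or32.
  by exists (l1 + f *+ K), f, 1%N, (K * k.-1)%N.
exists (rcons (rcons pf' l2) (l + f *+ K)); split.
- apply/cp_proof_rcons; split=> //; apply: Or33; exists l2, k.
  have kn0 : k%:Z != 0 by lia.
  have E1 v : l2.1 v = l1.1 v + f.1 v *+ K * k.
    by rewrite /l2 /= fst_mulrn ffunE ffunMnE mulrnA -mulr_natr natz.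
  split=> //; first by rewrite mem_rcons mem_head.
    by move=> v; rewrite E1 rpredD ?dv // dvdz_mull.
  have E2 : l2.2 = l1.2 + f.2 *+ K * k.
    by rewrite /l2 /= snd_mulrn mulrnA -[X in _ + X]mulr_natr natz.
  move: l2 E1 E2 {l2E pf2P} => l2 E1 E2; rewrite lE.
  apply/pair_eqP/andP; split; apply/eqP; rewrite /= ?fst_mulrn ?snd_mulrn.
    apply/ffunP => v; rewrite !ffunE ffunMnE E1 [in RHS]addrC.
    by rewrite divzMDl // addrC.
  by rewrite E2 [in RHS]addrC divzMDl // addrC.
- by rewrite !size_rcons doubleS !ltnS (leq_trans szpf).
- by rewrite !(mem_rcons, inE) fpf !orbT.
move=> l'; rewrite mem_rcons inE => /orP[/eqP->|].
  by exists K; rewrite mem_rcons mem_head.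
by move=> /liftP [K' K'P]; exists K'; rewrite !(mem_rcons, inE) K'P !orbT.
Qed.

(** The line -1 lifts to K f - 1. One more copy of [f] makes the multiplier positive even if K = 0,
    and division by K + 1 rounds to f - 1. The lift costs 2 s + 1 lines, the rest two. *)
Lemma derives_face H s f :
  H f -> refutes (add_hyp H (- f)) s -> derives H (s.*2 + 3) (f - one_form).
Proof.
move=> Hf [pf [pfP szpf onepf]].
have [pf' [pf'P szpf' fpf' liftP]] := cp_proof_face Hf pfP.
have [K KP] := liftP _ onepf.
have : derives H (size pf').+1 (f *+ K.+1 + one_form *~ (- 1)).
  exists (rcons pf' (f *+ K.+1 + one_form *~ (- 1))).
  split; rewrite ?size_rcons // ?mem_rcons ?mem_head //.
  apply/cp_proof_rcons; split=> //; apply: Or32.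
  exists (- one_form + f *+ K), f, 1%N, 1%N; split=> //.
  by rewrite !mulr1n mulrN1z -addrA -mulrSr addrC.
move=> /(derives_div (ltn0Sn K)); have -> : (- 1 %/ K.+1%:Z)%Z = - 1.
  by rewrite -[X in (X %/ _)%Z]/(Negz 0) divNz_nat ?div0n.
rewrite mulrN1z; apply: derives_leq.
by rewrite addn3 !ltnS (leq_trans szpf') // ltnS leq_double.
Qed.

Lemma refutes_mono H H' s s' :
  (forall h, H h -> H' h) -> (s <= s')%N -> refutes H s -> refutes H' s'.
Proof. exact: derives_mono. Qed.

(** Only the face branch f = 0 is doubled; the hypothesis f >= 1 of the other branch has then been
    derived, so chains of branchings through it grow additively. *)
Lemma refutes_branch H f s t : H f -> refutes (add_hyp H (- f)) s ->
  refutes (add_hyp H (f - one_form)) t -> refutes H (s.*2 + 3 + t).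
Proof. by move=> Hf /(derives_face Hf) P Q; apply: derives_cut P Q. Qed.

Lemma refutes_bounds H s t f (k k' : int) : k < k' ->
  derives H s (f - one_form *~ k') -> derives H t (one_form *~ k - f) ->
  refutes H (s + t).+2.
Proof.
move=> ltkk' fP kP; apply: (@refutes_neg _ _ (k - k')); first by lia.
have -> : one_form *~ (k - k') = (f - one_form *~ k') + (one_form *~ k - f).
  by rewrite mulrzBr [RHS]addrC addrA subrK.
exact: derives_add.
Qed.

(** The least value still possible is split off as a face; once the range is empty, the two bounds
    contradict each other in 4 lines. *)
Lemma refutes_exhaust H f s N (k : int) :
  H (f - one_form *~ k) -> H (one_form *~ (k + N%:Z - 1) - f) ->
  (forall k' : int, refutes
    (add_hyp (add_hyp H (f - one_form *~ k')) (one_form *~ k' - f)) s) ->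
  refutes H (N * (s.*2 + 3) + 4).
Proof.
elim: N H k => [|N IH] H k Hk HN sP.
  apply: (refutes_bounds _ (derives_hyp Hk) (derives_hyp HN)); lia.
rewrite mulSn -addnA; apply: (refutes_branch Hk).
  by apply: refutes_mono (sP k) => // h [[]|] Hh;
    [left | left; rewrite Hh | right; rewrite Hh opprB].
apply: (IH _ (k + 1)).
- by right; rewrite mulrzDr opprD addrA.
- by left; move: HN; congr (H (one_form *~ _ - f)); lia.
move=> k'; apply: refutes_mono (sP k') => // h [[]|] Hh.
- by left; left; left.
- by left; right.
by right.
Qed.

(** The face of [one_form - e u] is e u = 1, and leaving it yields e u <= 0. The last refutation
    starts with every [e u] excluded in this way. *)
Lemma refutes_cases H (T : eqType) (r : seq T) (e : T -> ineq V) s t :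
  (forall u, u \in r -> H (one_form - e u)) ->
  (forall u, u \in r -> refutes (add_hyp H (e u - one_form)) s) ->
  refutes (fun l => H l \/ exists2 u, u \in r & l = - e u) t ->
  refutes H (size r * (s.*2 + 3) + t).
Proof.
elim: r H => [|u r IH] H eH sP tP.
  by apply: refutes_mono tP => // l [//|[]].
rewrite mulSn -addnA; apply: (refutes_branch (eH u (mem_head _ _))).
  by rewrite opprB; apply: sP; rewrite mem_head.
apply: IH => [v vr|v vr|].
- by left; apply: eH; rewrite inE vr orbT.
- have vr' : v \in u :: r by rewrite inE vr orbT.
  by apply: refutes_mono (sP v vr') => // l [Hl|->]; [left; left | right].
apply: refutes_mono tP => // l [Hl|[v]]; first by left; left.
rewrite inE => /orP[/eqP->|vr] ->; last by right; exists v.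
by left; right; rewrite addrAC subrr sub0r.
Qed.

(** From p h = r, one division on each side gives h >= ceil(r / p) and h <= floor(r / p), which are
    one apart. *)
Lemma refutes_mod H s t h (p : nat) (r : int) :
  (0 < p)%N -> ~~ (p%:Z %| r)%Z ->
  derives H s (h *+ p - one_form *~ r) ->
  derives H t (one_form *~ r - h *+ p) -> refutes H (s.+1 + t.+1).+1.
Proof.
move=> p0 ndvd H1 H2.
rewrite -mulrNz in H1; rewrite addrC -mulNrn in H2.
have := derives_add (derives_div p0 H1) (derives_div p0 H2).
rewrite addrACA subrr add0r -mulrzDr.
suff -> : (- r %/ p)%Z + (r %/ p)%Z = - 1 by rewrite mulrN1z.
have pn0 : p%:Z != 0 by lia.
have m0 : (r %% p)%Z != 0 by apply: contraNneq ndvd => /dvdz_mod0P.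
have m_ge0 := modz_ge0 r pn0.
have m_lt := ltz_mod r pn0.
rewrite {1}(divz_eq r p).
have -> : - ((r %/ p)%Z * p%:Z + (r %% p)%Z) =
    (- (r %/ p)%Z - 1) * p%:Z + (p%:Z - (r %% p)%Z).
  by rewrite mulrBl mulNr mul1r opprD addrA subrK.
rewrite divzMDl // [X in _ + X + _]divz_small.
  by rewrite addr0 addrAC addNr add0r.
by move: m0 m_ge0 m_lt; move: (r %% p)%Z => m; lia.
Qed.

End CuttingPlanes.

(** * Linear algebra over a finite field *)

Lemma unsatisfiable_witness (F : finFieldType) (m n : nat) (A : 'M[F]_(m, n))
    (b : 'cV[F]_m) : unsatisfiable A b ->
  exists y : 'rV[F]_m, y *m A = 0 /\ (y *m b) 0 0 != 0.
Proof.
move=> unsat; have : ~~ (b^T <= A^T)%MS.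
  apply/negP => /submxP [D bE]; apply: unsat; exists D^T.
  by rewrite -[A]trmxK -trmx_mul -bE trmxK.
rewrite submxE => /matrix0Pn [i [j]]; rewrite ord1 => nz.
(* A column of the cokernel matrix that kills [A^T] but not [b^T]. *)
pose y := cokermx A^T *m delta_mx j (0 : 'I_1); exists y^T; split.
  by rewrite -[A in LHS]trmxK -trmx_mul mulmxA mulmx_coker mul0mx trmx0.
by rewrite -[b]trmxK -trmx_mul mulmxA -colE [_^T 0 0]mxE [col _ _ _ _]mxE.
Qed.

(** [F] is a vector space over its prime field; [g] reads off a coordinate at which 1 does not
    vanish. *)
Lemma residue_functional (F : finFieldType) : exists (p : nat) (g : F -> nat),
  [/\ (1 < p <= #|F|)%N, {morph g : x y / x + y >-> ((x + y) %% p)%N},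
      forall x, (g x < p)%N & exists x, g x != 0%N].
Proof.
have [p p_pr pcharFp] := finPcharP F.
pose L : vectType 'F_p := pPrimeCharType pcharFp.
have p1 := prime_gt1 p_pr.
pose X := vbasis (fullv : {vspace L}).
have [i xi] : exists i, coord X i (1 : pPrimeCharType pcharFp) != 0.
  apply/existsP; rewrite -negb_forall; apply/negP => /forallP x0.
  have := coord_vbasis (memvf (1 : pPrimeCharType pcharFp)).
  rewrite big1 => [/eqP|j _]; first by rewrite oner_eq0.
  by have /eqP -> := x0 j; rewrite scale0r.
exists p, (fun x : F => (coord X i (x : L) : ordinal _) : nat); split.
- rewrite p1 /=.
  have cardF := card_pprimeChar pcharFp.
  move: (card_finNzRing_gt1 F); rewrite [#|F|]cardF; case: logn => // k _.
  by rewrite -{1}[p]expn1 leq_exp2l.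
- by move=> x y; rewrite raddfD /=; congr (_ %% _)%N; rewrite Fp_cast.
- by move=> x; rewrite -[X in (_ < X)%N](Fp_cast p_pr) ltn_ord.
by exists 1.
Qed.

(** * Literals and clauses as affine forms *)

Section LiteralForms.

Variable V : finType.

(** Read as an affine form, a bound axiom is the 0-1 value of a literal: v for the lower bound, 1 -
    v for the upper one. *)
Definition lit_form (l : literal V) : ineq V :=
  if l.2 then lower_bound l.1 else upper_bound l.1.

Lemma lit_form_negl (l : literal V) :
  lit_form (negl l) = one_form V - lit_form l.
Proof.
case: l => v [] /=; apply/pair_eqP; rewrite /lit_form /=.
  by apply/andP; split=> //; apply/eqP/ffunP => u; rewrite !ffunE opprK add0r.
by apply/andP; split=> //; apply/eqP/ffunP => u; rewrite !ffunE add0r.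
Qed.

(** A variable occurring with both signs contributes v + (1 - v), so its coefficient cancels and the
    constant 1 remains, as in the standard translation. *)
Lemma clause_ineqE (C : {set literal V}) :
  clause_ineq C = \sum_(l in C) lit_form l - one_form V.
Proof.
have sum_pairs (M : nmodType) (G : literal V -> M) :
    \sum_(l in C) G l =
      \sum_v ((if (v, true) \in C then G (v, true) else 0) +
              (if (v, false) \in C then G (v, false) else 0)).
  pose G' v t := if (v, t) \in C then G (v, t) else 0.
  transitivity (\sum_v \sum_t G' v t).
    by rewrite pair_bigA big_mkcond; apply: eq_bigr => -[].
  by apply: eq_bigr => v _; rewrite big_bool.
apply/pair_eqP/andP; split; apply/eqP => /=.
  apply/ffunP => v; rewrite !ffunE oppr0 addr0.
  rewrite (big_morph (fun l : ineq V => l.1 v) (id1 := 0) (op1 := +%R));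
    first last.
  - by rewrite ffunE.
  - by move=> x y; rewrite ffunE.
  rewrite sum_pairs (bigD1 v) //= big1 => [|u nuv].
    rewrite !ffunE eqxx addr0 addrC.
    by case: ((v, true) \in C); case: ((v, false) \in C).
  by rewrite !ffunE eq_sym (negPf nuv) oppr0 !if_same addr0.
rewrite (big_morph (fun l : ineq V => l.2) (id1 := 0) (op1 := +%R)) //.
rewrite sum_pairs -sum1_card big_mkcond -natz natr_sum /=.
congr (_ - 1); apply: eq_bigr => v _.
by rewrite inE !if_same add0r; case: ifP.
Qed.

End LiteralForms.

(** * Axioms supplied by the encoding *)

Section EncodingAxioms.

Variables (F : finFieldType) (B : finType) (lit : F -> literal B).
Variables (m n : nat) (A : 'M[F]_(m, n)) (b : 'cV[F]_m).
Hypothesis litP : value_encoding lit.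

Definition val_form (j : 'I_n) (u : F) : ineq ('I_n * B)%type :=
  lit_form (value_lit lit j u).

Local Notation e := val_form.
Local Notation unit := (one_form ('I_n * B)%type).
Local Notation axioms := (cnf_ineq (cnf lit A b)).

(** Lets sums over the literals of a clause be reindexed by values or variables without merging
    terms. *)
Lemma lit_inj : injective lit.
Proof.
move=> a a' eq_lit; have [w wP] := litP a.
by apply/eqP; rewrite eq_sym -wP -eq_lit wP.
Qed.

Lemma value_lit_inj (j j' : 'I_n) a a' :
  value_lit lit j a = value_lit lit j' a' -> j = j' /\ a = a'.
Proof.
case=> -> eq1 eq2; split=> //; apply: lit_inj.
by rewrite [lit a]surjective_pairing eq1 eq2 -surjective_pairing.
Qed.

Lemma negl_inj (V : Type) : injective (@negl V).
Proof. by move=> [v s] [v' s'] [-> /negb_inj ->]. Qed.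

Lemma lit_form_axiom l : axioms (lit_form l).
Proof.
case: l => v []; first by apply: Or33; exists v.
by apply: Or32; exists v.
Qed.

Lemma clause_axiom C (l : ineq _) :
  C \in cnf lit A b -> l = \sum_(l in C) lit_form l - unit -> axioms l.
Proof. by move=> CP ->; rewrite -clause_ineqE; apply: Or31; exists C. Qed.

Lemma val_ge0 j u : axioms (e j u).
Proof. exact: lit_form_axiom. Qed.

Lemma val_le1 j u : axioms (unit - e j u).
Proof. by rewrite -lit_form_negl; apply: lit_form_axiom. Qed.

Lemma val_exists j : axioms (\sum_u e j u - unit).
Proof.
apply: (@clause_axiom [set value_lit lit j a | a : F]).
  rewrite inE; apply/orP; right; apply/bigcupP; exists j => //.
  by rewrite !inE eqxx.
by rewrite big_imset //= => u v _ _ /value_lit_inj [].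
Qed.

Lemma val_unique j u v : u != v -> axioms (unit - e j u - e j v).
Proof.
move=> nuv.
apply: (@clause_axiom [set negl (value_lit lit j u); negl (value_lit lit j v)]).
  rewrite inE; apply/orP; right; apply/bigcupP; exists j => //.
  by rewrite inE; apply/orP; right; apply/imsetP; exists (u, v); rewrite ?inE.
rewrite big_setU1 ?big_set1 /=; last first.
  rewrite inE; apply: contra nuv => /eqP /negl_inj /value_lit_inj [_ ->].
  exact: eqxx.
by rewrite !lit_form_negl -[RHS]addrA [X in _ = _ + X]addrAC subrr sub0r.
Qed.

Lemma equation_axiom i (x : 'cV[F]_n) : (A *m x) i 0 != b i 0 ->
  axioms (\sum_(j in Defs.support A i) (unit - e j (x j 0)) - unit).
Proof.
move=> neq; apply: (@clause_axiom (forbid lit A i x)).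
  rewrite inE; apply/orP; left; apply/bigcupP; exists i => //.
  by apply/imsetP; exists x; rewrite ?inE.
rewrite big_imset /=; last by move=> j k _ _ /negl_inj /value_lit_inj [].
by congr (_ - _); apply: eq_bigr => j _; rewrite lit_form_negl.
Qed.

End EncodingAxioms.

Lemma addrBACA (M : zmodType) (x1 x2 x3 y1 y2 y3 : M) :
  x1 + x2 - x3 - (y1 + y2 - y3) = (x1 - y1) + (x2 - y2) + (y3 - x3).
Proof. by rewrite !opprD opprK addrACA [X in X + _]addrACA [- x3 + _]addrC. Qed.

Lemma sum_setX (M : nmodType) (I J : finType) (U : {set I}) (G : I * J -> M) :
  \sum_(w <- enum (setX U [set: J])) G w = \sum_(j in U) \sum_u G (j, u).
Proof.
rewrite big_enum pair_big_dep /=.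
by apply: eq_big => [[j u]|[]]; rewrite ?inE ?andbT.
Qed.

(** * Residue forms modulo p and their refutation *)

Section ResidueFunctional.

Variables (F : finFieldType) (p : nat) (g : F -> nat).
Hypothesis p_gt1 : (1 < p)%N.
Hypothesis gD : {morph g : x y / x + y >-> ((x + y) %% p)%N}.
Hypothesis g_lt : forall x, (g x < p)%N.

Lemma residue0 : g 0 = 0%N.
Proof.
have /eqP := gD 0 0; rewrite addr0 -{1}(modn_small (g_lt 0)) -{1}[g 0]addn0.
by rewrite eqn_modDl mod0n modn_small // => /eqP <-.
Qed.

Lemma residue_sum (I : Type) (r : seq I) (P : pred I) (x : I -> F) :
  g (\sum_(i <- r | P i) x i) = ((\sum_(i <- r | P i) g (x i)) %% p)%N.
Proof.
elim/big_rec2: _ => [|i y1 y2 _ IH]; first by rewrite residue0 mod0n.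
by rewrite gD IH modnDmr.
Qed.

Variables (B : finType) (lit : F -> literal B).
Variables (m n : nat) (A : 'M[F]_(m, n)) (b : 'cV[F]_m).
Hypothesis litP : value_encoding lit.

Local Notation e := (val_form lit).
Local Notation unit := (one_form ('I_n * B)%type).
Local Notation axioms := (cnf_ineq (cnf lit A b)).
Local Notation q := #|F|.
Implicit Types (H : ineq ('I_n * B)%type -> Prop) (a : 'rV[F]_n).

(** The form f_S, when [a] is the S-part of the combination of rows. *)
Definition residue_form a : ineq ('I_n * B)%type :=
  \sum_j \sum_u e j u *+ g (a 0 j * u).

(** Dropping the zero columns makes the number of summands independent of [n]. *)
Lemma residue_formE a (U : {set 'I_n}) : (forall j, j \notin U -> a 0 j = 0) ->
  residue_form a =
    \sum_(w <- enum (setX U [set: F])) e w.1 w.2 *+ g (a 0 w.1 * w.2).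
Proof.
move=> aU; rewrite sum_setX /residue_form.
rewrite (bigID (mem U)) /= [X in _ + X]big1 ?addr0 => [|j /aU ->].
  by [].
by rewrite big1 // => u _; rewrite mul0r residue0.
Qed.

Lemma size_enum_setX (U : {set 'I_n}) :
  size (enum (setX U [set: F])) = (#|U| * q)%N.
Proof. by rewrite -cardE cardsX cardsT. Qed.

(** * A single equation *)

Section Leaf.

Variables (i : 'I_m) (y : F) (k : int).
Local Notation a := (y *: row i A).
Local Notation supp := (Defs.support A i).
Hypothesis k_neq : ~~ (p%:Z %| (k - (g (y * b i 0))%:Z)%R)%Z.

(** If [x] violates the equation, the corresponding clause fails. Otherwise all literals in the form
    are determined, and its value [k0] has the right residue, so it differs from [k]. *)
Lemma refutes_assignment H (x : 'cV[F]_n) :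
  (forall h, axioms h -> H h) ->
  H (residue_form a - unit *~ k) -> H (unit *~ k - residue_form a) ->
  (forall j, j \in supp -> H (e j (x j 0) - unit)) ->
  refutes H (2 + 4 * (#|supp| * q)).
Proof.
move=> axH Hge Hle xP.
have q0 : (0 < q)%N by apply: ltnW; apply: card_finNzRing_gt1.
have arith c q' : (0 < q')%N -> (1 + c * 2 <= 2 + 4 * (c * q'))%N by nia.
have [eqb|neqb] := eqVneq ((A *m x) i 0) (b i 0); last first.
  have := derives_hyp (axH _ (equation_axiom litP neqb)).
  move=> /(@derives_sum _ _ _ 1 _ _ (enum supp) (fun=> 1%N)
            (fun j => e j (x j 0) - unit)).
  rewrite -cardE big_enum /= addrAC -big_split /= big1 => [|j _].
    rewrite sub0r => P; apply: derives_leq (P _); first exact: arith.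
    by move=> j; rewrite mem_enum => /xP /derives_hyp.
  by rewrite mulr1n addrA subrK subrr.
pose d (w : 'I_n * F) : int := (w.2 == x w.1 0)%:Z.
have dP w : w \in enum (setX supp [set: F]) ->
    derives H 3 (e w.1 w.2 - unit *~ d w) /\
    derives H 3 (unit *~ d w - e w.1 w.2).
  rewrite mem_enum inE => /andP [/xP Hx _]; rewrite /d.
  have [->|neqx] := eqVneq w.2 (x w.1 0).
    rewrite mulr1z; split; apply: (@derives_leq _ _ 1) => //.
      exact: derives_hyp.
    by apply: derives_hyp; apply: axH; apply: val_le1.
  rewrite mulr0z subr0 sub0r; split.
    by apply: (@derives_leq _ _ 1) => //; apply/derives_hyp/axH/val_ge0.
  (* The variable already takes the value given by [x], so uniqueness excludes any other. *)
  have := derives_add (derives_hyp (axH _ (val_unique A b litP w.1 neqx)))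
                      (derives_hyp Hx).
  by rewrite addrA subrK addrAC subrr sub0r.
pose c (w : 'I_n * F) := g (a 0 w.1 * w.2).
pose k0 : int := \sum_(w <- enum (setX supp [set: F])) d w *+ c w.
have formE : residue_form a =
    \sum_(w <- enum (setX supp [set: F])) e w.1 w.2 *+ c w.
  apply: residue_formE => j; rewrite inE negbK !mxE => /eqP ->.
  by rewrite mulr0.
have k0E : unit *~ k0 =
    \sum_(w <- enum (setX supp [set: F])) (unit *~ d w) *+ c w.
  rewrite /k0 (big_morph _ (@mulrzDr _ _) (mulr0z _)); apply: eq_bigr => w _.
  by rewrite -mulr_natr natz mulrzA -pmulrn.
have neqk : k != k0.
  apply: contraNneq k_neq => ->.
  have -> : k0 = (\sum_(j in supp) g (a 0 j * x j 0)%R)%N%:Z.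
    rewrite /k0 sum_setX -natz natr_sum; apply: eq_bigr => j _.
    rewrite (bigD1 (x j 0)) //= big1 => [|u /negPf nu].
      by rewrite /d /c /= eqxx addr0 -mulr_natr mul1r.
    by rewrite /d /= nu mul0rn.
  have -> : y * b i 0 = \sum_(j in supp) a 0 j * x j 0.
    rewrite -eqb !mxE mulr_sumr (bigID (mem supp)) /= [X in _ + X]big1 ?addr0.
      by apply: eq_bigr => j _; rewrite !mxE mulrA.
    by move=> j; rewrite inE negbK => /eqP ->; rewrite mul0r mulr0.
  rewrite residue_sum.
  by rewrite -eqz_mod_dvd -modz_nat modz_mod.
have Nle : (1 + (#|supp| * q) * 4 < 2 + 4 * (#|supp| * q))%N by lia.
have [ltk|ltk|/eqP] := ltgtP k k0; last by rewrite (negPf neqk).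
  apply: derives_leq Nle _; apply: (@refutes_neg _ _ _ (k - k0)); first by lia.
  have -> : unit *~ (k - k0) = (unit *~ k - residue_form a) +
      \sum_(w <- enum (setX supp [set: F])) (e w.1 w.2 - unit *~ d w) *+ c w.
    under eq_bigr do rewrite mulrnDl mulNrn.
    by rewrite big_split sumrN /= -formE -k0E addrA subrK mulrzBr.
  rewrite -size_enum_setX; apply: derives_sum (derives_hyp Hle) _.
  by move=> w /dP [].
apply: derives_leq Nle _; apply: (@refutes_neg _ _ _ (k0 - k)); first by lia.
have -> : unit *~ (k0 - k) = (residue_form a - unit *~ k) +
    \sum_(w <- enum (setX supp [set: F])) (unit *~ d w - e w.1 w.2) *+ c w.
  under eq_bigr do rewrite mulrnDl mulNrn.
  rewrite big_split sumrN /= -formE -k0E mulrzBr addrCA.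
  by rewrite addrAC subrr add0r.
rewrite -size_enum_setX; apply: derives_sum (derives_hyp Hge) _.
by move=> w /dP [].
Qed.

Lemma refutes_equation H d :
  (#|supp| <= d)%N -> (forall h, axioms h -> H h) ->
  H (residue_form a - unit *~ k) -> H (unit *~ k - residue_form a) ->
  refutes H ((8 * q) ^ d * (2 + 4 * (d * q))).
Proof.
have q0 : (0 < q)%N by apply: ltnW; apply: card_finNzRing_gt1.
(* [r] lists the variables still to be branched on, and [x] records the values chosen for the others
   in the support; each variable costs a factor [8 * q]. *)
have branching (r : seq 'I_n) H' (x : 'cV[F]_n) :
    (forall h, axioms h -> H' h) ->
    H' (residue_form a - unit *~ k) -> H' (unit *~ k - residue_form a) ->
    (forall j, j \in supp -> j \notin r -> H' (e j (x j 0) - unit)) ->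
    refutes H' ((8 * q) ^ size r * (2 + 4 * (#|supp| * q))).
  elim: r H' x => [|j r IH] H' x axH Hge Hle xP.
    rewrite expn0 mul1n.
    by apply: (refutes_assignment axH Hge Hle) => j /xP; apply.
  set T := (_ * _)%N in IH.
  have T0 : (0 < T)%N by rewrite muln_gt0 expn_gt0 muln_gt0 q0.
  pose H'' l := H' l \/ exists2 u, u \in enum F & l = - e j u.
  (* With every value excluded, the at-least-one clause of the block fails. *)
  have last_case : refutes H'' (1 + q * 2).
    have Hj : derives H'' 1 (\sum_u e j u - unit).
      by apply: derives_hyp; left; apply: axH; apply: val_exists.
    have := @derives_sum _ _ _ 1 _ _ (enum F) (fun=> 1%N) (fun u => - e j u) Hj.
    rewrite -cardE big_enum /= addrAC -big_split /= big1 => [|u _]; last first.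
      by rewrite subrr.
    by rewrite sub0r; apply=> u uF; apply: derives_hyp; right; exists u.
  have step : refutes H' (size (enum F) * (T.*2 + 3) + (1 + q * 2)).
    apply: (refutes_cases (e := e j)) last_case => u _.
      by apply: axH; apply: val_le1.
    apply: (IH _ (\col_j' if j' == j then u else x j' 0)).
    - by move=> h /axH; left.
    - by left.
    - by left.
    move=> j' j'P j'r; rewrite mxE; case: eqVneq => [->|neqj]; first by right.
    by left; apply: xP; rewrite // inE negb_or neqj.
  apply: derives_leq step; rewrite -cardE /= expnS -mulnA -/T.
  have arith q' : (0 < q')%N ->
    (q' * (T.*2 + 3) + (1 + q' * 2) <= 8 * q' * T)%N by nia.
  exact: arith.
move=> led axH Hge Hle.
(* Nothing in the support is fixed yet, so the initial assignment 0 asserts nothing. *)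
have := branching (enum supp) H 0 axH Hge Hle; rewrite -cardE => P.
apply: derives_leq (P _) => [|j]; last by rewrite mem_enum => ->.
apply: leq_mul; first by rewrite leq_pexp2l // muln_gt0.
by rewrite leq_add2l leq_mul2l leq_mul2r led orbT.
Qed.

End Leaf.

(** * Recursive halving of the system *)

Section Recursion.

Variables (y : 'rV[F]_m) (U : {set 'I_n}) (d : nat).
Hypothesis p_le : (p <= q)%N.
Hypothesis supportU : forall i, Defs.support A i \subset U.
Hypothesis width : has_width A d.
Local Notation N := (#|U| * q)%N.

Definition comb_row (S : seq 'I_m) : 'rV[F]_n :=
  \sum_(i <- S) y 0 i *: row i A.

Definition comb_rhs (S : seq 'I_m) : F := \sum_(i <- S) y 0 i * b i 0.

(** Two derivations for the bounds 0 <= f <= M, then branching over at most N q + 1 values. *)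
Definition exhaust_size (s : nat) : nat :=
  (2 + N * 2 + (2 + N * 2 + ((N * q + 1) * (s.*2 + 3) + 4)))%N.

Lemma comb_row_support S j : j \notin U -> comb_row S 0 j = 0.
Proof.
move=> jU; rewrite /comb_row summxE big1 // => i _; rewrite !mxE.
have : j \notin Defs.support A i.
  by apply: contra jU; apply: (subsetP (supportU i)).
by rewrite inE negbK => /eqP ->; rewrite mulr0.
Qed.

Lemma residue_form_exhaust H S s :
  (forall h, axioms h -> H h) -> (exists h, axioms h) ->
  (forall k : int, refutes (add_hyp (add_hyp H
     (residue_form (comb_row S) - unit *~ k))
     (unit *~ k - residue_form (comb_row S))) s) ->
  refutes H (exhaust_size s).
Proof.
move=> axH [h0 /axH Hh0] sP; set f := residue_form _ in sP.
have fE := residue_formE (comb_row_support S).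
pose M := (\sum_(w <- enum (setX U [set: F])) g (comb_row S 0%R w.1 * w.2)%R)%N.
have fge0 : derives H (2 + N * 2) f.
  rewrite -[f]add0r /f fE -size_enum_setX.
  apply: derives_sum (derives_zero Hh0) _ => w _.
  exact/derives_hyp/axH/val_ge0.
have fleM : derives H (2 + N * 2) (unit *~ M%:Z - f).
  have -> : unit *~ M%:Z - f = 0 + \sum_(w <- enum (setX U [set: F]))
      (unit - e w.1 w.2) *+ g (comb_row S 0 w.1 * w.2).
    under eq_bigr do rewrite mulrnDl mulNrn.
    by rewrite big_split sumrN /= -fE sumrMnr add0r -pmulrn.
  rewrite -size_enum_setX; apply: derives_sum (derives_zero Hh0) _ => w _.
  exact/derives_hyp/axH/val_le1.
(* Each coefficient is a residue below p <= q. *)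
have Mle : (M <= N * q)%N.
  have -> : (N * q)%N = (\sum_(w in setX U [set: F]) q)%N.
    by rewrite sum_nat_const cardsX cardsT.
  rewrite /M big_enum; apply: leq_sum => w _; apply: ltnW.
  exact: leq_trans p_le.
rewrite /exhaust_size; apply: (derives_cut fge0).
have add1 l : H l -> add_hyp H f l by left.
apply: (derives_cut (derives_mono add1 (leqnn _) fleM)).
apply: (@derives_leq _ _ (M.+1 * (s.*2 + 3) + 4)).
  by rewrite leq_add2r leq_mul2r addn1 ltnS Mle orbT.
apply: (refutes_exhaust (f := f) (k := 0)).
- by rewrite mulr0z subr0; left; right.
- by rewrite add0r -addn1 PoszD addrK; right.
move=> k; apply: refutes_mono (sP k) => // h [[Hh|->]|->].
- by left; left; left; left.
- by left; right.
by right.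
Qed.

(* The summand 13 pays for the contradiction modulo p. *)
Definition leaf_size := ((8 * q) ^ d * (2 + 4 * (d * q)) + 13)%N.

Lemma exhaust_size_ge s : (s <= exhaust_size s)%N.
Proof.
have arith c c' : (s <= c + (c + ((c' + 1) * (s.*2 + 3) + 4)))%N by clear; nia.
exact: arith.
Qed.

(** Each coefficient of [h] is the carry in the addition of two residues modulo p. *)
Lemma residue_formD a a' : exists h,
  h *+ p = residue_form a + residue_form a' - residue_form (a + a').
Proof.
exists (\sum_j \sum_u e j u *+ ((g (a 0 j * u)%R + g (a' 0 j * u)%R) %/ p)).
rewrite -sumrMnl -big_split -sumrB; apply: eq_bigr => j _ /=.
rewrite -sumrMnl -big_split -sumrB; apply: eq_bigr => u _ /=.
rewrite mxE mulrDl gD -mulrnDr {2}(divn_eq (g (a 0 j * u) + _) p).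
by rewrite mulrnDr addrK mulrnA.
Qed.

(** Each level enumerates the values of two forms, one per half, hence two applications of
    [exhaust_size]. *)
Lemma refutes_system r H S (k : int) :
  (forall h, axioms h -> H h) -> (exists h, axioms h) ->
  (size S <= 2 ^ r)%N ->
  H (residue_form (comb_row S) - unit *~ k) ->
  H (unit *~ k - residue_form (comb_row S)) ->
  ~~ (p%:Z %| (k - (g (comb_rhs S))%:Z)%R)%Z ->
  refutes H (iter r (exhaust_size \o exhaust_size) leaf_size).
Proof.
move=> axH [h0 h0P]; elim: r H S k axH => [|r IH] H S k axH szS Hge Hle kP.
  (* Splitting may leave an empty part: its form is 0, while the wrong residue makes [k] nonzero. *)
  case: S szS Hge Hle kP => [|i [|]] //= _ Hge Hle kP.
    have f0 : residue_form (comb_row [::]) = 0.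
      rewrite /residue_form big1 // => j _; rewrite big1 // => u _.
      by rewrite /comb_row big_nil mxE mul0r residue0.
    rewrite f0 sub0r in Hge; rewrite f0 subr0 in Hle.
    have kn0 : k != 0.
      apply: contraNneq kP => ->.
      by rewrite /comb_rhs big_nil residue0 subr0 dvdz0.
    apply: (@derives_leq _ _ 2); first by rewrite /leaf_size; lia.
    have [k0|k0|/eqP] := ltgtP k 0; last by rewrite (negPf kn0).
      exact: (refutes_neg k0 (derives_hyp Hle)).
    apply: (@refutes_neg _ _ _ (- k)); first by lia.
    by rewrite mulrNz; apply: derives_hyp.
  rewrite /comb_row /comb_rhs !big_seq1 in Hge Hle kP.
  apply: derives_leq (refutes_equation kP (width i) axH Hge Hle).
  exact: leq_addr.
rewrite iterS; set T := iter r _ _ in IH *.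
have T13 : (13 <= T)%N.
  rewrite /T; elim: (r) => [|r' IHr]; first exact: leq_addl.
  apply: (leq_trans IHr); rewrite iterS /=.
  by apply: (leq_trans (exhaust_size_ge _)); apply: exhaust_size_ge.
pose S1 := take (2 ^ r) S; pose S2 := drop (2 ^ r) S.
have rowS : comb_row S = comb_row S1 + comb_row S2.
  by rewrite /comb_row -big_cat cat_take_drop.
have rhsS : comb_rhs S = comb_rhs S1 + comb_rhs S2.
  by rewrite /comb_rhs -big_cat cat_take_drop.
apply: (residue_form_exhaust (S := S1)) => // [|k1]; first by exists h0.
apply: (residue_form_exhaust (S := S2)) => [h /axH Hh||k2].
- by left; left.
- by exists h0.
set H' := add_hyp _ _.
have axH' h : axioms h -> H' h by move/axH=> Hh; left; left; left; left.
have H1ge : H' (residue_form (comb_row S1) - unit *~ k1).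
  by left; left; left; right.
have H1le : H' (unit *~ k1 - residue_form (comb_row S1)).
  by left; left; right.
have H2ge : H' (residue_form (comb_row S2) - unit *~ k2) by left; right.
have H2le : H' (unit *~ k2 - residue_form (comb_row S2)) by right.
have [d1|] := boolP (p%:Z %| (k1 - (g (comb_rhs S1))%:Z)%R)%Z; last first.
  by apply: IH => //; rewrite size_take_min geq_minl.
have [d2|] := boolP (p%:Z %| (k2 - (g (comb_rhs S2))%:Z)%R)%Z; last first.
  apply: IH => //; rewrite size_drop leq_subLR addnn -mul2n -expnS.
  exact: szS.
have [h hE] := residue_formD (comb_row S1) (comb_row S2).
rewrite -rowS in hE.
(* Five lines for each of the two bounds on p h, two divisions and a final sum: 13. *)
apply: (@derives_leq _ _ (((1 + 1).+1 + 1).+2 + ((1 + 1).+1 + 1).+2).+1) => //.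
apply: (refutes_mod (h := h) (p := p) (r := k1 + k2 - k)); first exact: ltnW.
(* The residues of the two right-hand sides add up to that of the whole plus a multiple of p, so p
   dividing k1 + k2 - k would give [k] the right residue. *)
- apply: contra kP => d3.
  have -> : k - (g (comb_rhs S))%:Z =
      (k1 - (g (comb_rhs S1))%:Z) + (k2 - (g (comb_rhs S2))%:Z) -
      (k1 + k2 - k) +
      ((g (comb_rhs S1) + g (comb_rhs S2)) %/ p)%N%:Z * p%:Z.
    rewrite rhsS gD; have := divn_eq (g (comb_rhs S1) + g (comb_rhs S2)) p.
    by move: (_ %/ p)%N (_ %% p)%N => u v; lia.
  apply: rpredD; last by apply: dvdz_mull; apply: dvdzz.
  by apply: rpredB => //; apply: rpredD.
- rewrite hE.
  have -> : residue_form (comb_row S1) + residue_form (comb_row S2)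
       - residue_form (comb_row S) - unit *~ (k1 + k2 - k) =
     (residue_form (comb_row S1) - unit *~ k1) +
     (residue_form (comb_row S2) - unit *~ k2) +
     (unit *~ k - residue_form (comb_row S)).
    by rewrite mulrzBr mulrzDr addrBACA.
  apply: derives_add (derives_add _ _) _; apply: derives_hyp => //.
  by left; left; left; left.
rewrite hE.
have -> : unit *~ (k1 + k2 - k) -
       (residue_form (comb_row S1) + residue_form (comb_row S2)
         - residue_form (comb_row S)) =
     (unit *~ k1 - residue_form (comb_row S1)) +
     (unit *~ k2 - residue_form (comb_row S2)) +
     (residue_form (comb_row S) - unit *~ k).
  by rewrite mulrzBr mulrzDr addrBACA.
apply: derives_add (derives_add _ _) _; apply: derives_hyp => //.
  by left; left; left; left.
Qed.

End Recursion.

End ResidueFunctional.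

Lemma card_bigcup_le (I T : finType) (S : I -> {set T}) d :
  (forall i, #|S i| <= d)%N -> (#|\bigcup_i S i| <= #|I| * d)%N.
Proof.
move=> Sd; rewrite -sum_nat_const.
apply: (@leq_trans (\sum_i #|S i|)); last exact: leq_sum.
apply: (big_rec2 (fun (X : {set T}) k => #|X| <= k)%N) => [|i X k _ IH].
  by rewrite cards0.
by apply: leq_trans (leq_card_setU _ _) _; rewrite leq_add2l.
Qed.

(** * Numerical estimates *)

Section SizeBounds.

Variables (m q d : nat).
Hypotheses (m2 : (1 < m)%N) (q2 : (1 < q)%N).
(** The exponent [d.+1], in place of [d.-1], lets powers of [W] absorb factors d and q uniformly in
    d; the final theorem converts back. *)
Local Notation W := (m * q ^ d.+1)%N.

Lemma base_ge4 : (4 <= W)%N.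
Proof.
have qd0 : (0 < q ^ d)%N by rewrite expn_gt0 ltnW.
by rewrite expnS mulnA (leq_trans (leq_mul m2 q2)) // leq_pmulr.
Qed.

Lemma leaf_size_le : ((8 * q) ^ d * (2 + 4 * (d * q)) + 13 <= W ^ 8)%N.
Proof.
have W4 := base_ge4.
have qdW : (q ^ d.+1 <= W)%N by rewrite leq_pmull // ltnW.
have h1 : ((8 * q) ^ d <= W ^ 4)%N.
  have q84 : (8 * q <= q ^ 4)%N.
    by rewrite expnSr leq_mul2r (@leq_exp2r 2 q 3) // q2 orbT.
  apply: (@leq_trans ((q ^ d) ^ 4)).
    rewrite -expnM [(d * 4)%N]mulnC expnM; case: (d) => // d'.
    by rewrite leq_exp2r.
  by rewrite leq_exp2r // (leq_trans _ qdW) // leq_pexp2l // ltnW.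
have h2 : (d * q <= W)%N.
  apply: leq_trans qdW; rewrite expnS mulnC leq_mul2l ltnW ?orbT //.
  exact: ltn_expl.
move: W W4 h1 h2 {qdW} => W W4 h1 h2.
have h3 : (2 + 4 * (d * q) <= W ^ 3)%N by rewrite !expnS expn0; nia.
have := leq_mul h1 h3; rewrite -expnD => h4.
have : (W ^ 7 + 13 <= W ^ 8)%N.
  have : (16 <= W ^ 7)%N by rewrite !expnS expn0; nia.
  by rewrite [(W ^ 8)%N]expnS; nia.
by apply: leq_trans; rewrite leq_add2r.
Qed.

Lemma exhaust_size_le N s : (N <= m * d * q)%N -> (0 < s)%N ->
  (2 + N * 2 + (2 + N * 2 + ((N * q + 1) * (s.*2 + 3) + 4)) <= W ^ 4 * s)%N.
Proof.
move=> Nle s0; have W4 := base_ge4.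
have NqW : (N * q <= W ^ 2)%N.
  rewrite -mulnn; apply: (@leq_trans (m * d * q * q)).
    by rewrite leq_mul2r Nle orbT.
  rewrite leq_mul //.
    rewrite -mulnA leq_mul2l expnS [(d * q)%N]mulnC leq_mul2l.
    by rewrite (ltnW (ltn_expl d q2)) !orbT.
  rewrite expnS mulnCA leq_pmulr // muln_gt0 expn_gt0 ltnW //= ltnW //.
have NleNq : (N <= N * q)%N by rewrite leq_pmulr // ltnW.
move: W W4 NqW => W W4 NqW.
have h1 : (10 * W ^ 2 <= W ^ 4)%N.
  by rewrite (expnD W 2 2) leq_mul2r -mulnn; apply/orP; right; nia.
have h2 : (16 <= W ^ 2)%N by rewrite -mulnn; nia.
apply: (@leq_trans (10 * W ^ 2 * s)); last by rewrite leq_mul2r h1 orbT.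
by move: (N * q)%N (W ^ 2)%N NqW h2 NleNq => x z; nia.
Qed.

End SizeBounds.

(** Each level multiplies the size by at most [Y ^ 2]; [s <= C s] keeps sizes positive, as the
    linear bound requires. *)
Lemma iter_exhaust_le (C : nat -> nat) (Y s0 r : nat) : (0 < s0)%N ->
  (forall s, s <= C s)%N -> (forall s, 0 < s -> C s <= Y * s)%N ->
  (0 < iter r (C \o C) s0 <= Y ^ (2 * r) * s0)%N.
Proof.
move=> s00 Cge Cle; elim: r => [|r /andP [T0 Tle]].
  by rewrite muln0 expn0 mul1n /= s00 leqnn.
rewrite iterS /=; set T := iter r _ _ in T0 Tle *.
have CT0 : (0 < C T)%N by apply: leq_trans T0 (Cge T).
rewrite (leq_trans CT0 (Cge _)) /=; apply: leq_trans (Cle _ CT0) _.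
rewrite mulnS expnD -mulnn -!mulnA leq_mul2l; apply/orP; right.
by apply: leq_trans (Cle _ T0) _; rewrite leq_mul2l Tle orbT.
Qed.

(** * From an unsatisfiable system to the final bound *)

Lemma unsatisfiable_rhs (F : finFieldType) (m n : nat) (A : 'M[F]_(m, n))
    (b : 'cV[F]_m) : unsatisfiable A b -> exists i, b i 0 != 0.
Proof.
move=> unsat; apply/existsP; rewrite -negb_forall; apply/negP => /forallP b0.
apply: unsat; exists 0; rewrite mulmx0; apply/colP => i.
by rewrite mxE; have /eqP -> := b0 i.
Qed.

Lemma refutes_unsatisfiable (F : finFieldType) (B : finType)
    (lit : F -> literal B) (m n d : nat) (A : 'M[F]_(m, n)) (b : 'cV[F]_m) :
  (1 < m)%N -> value_encoding lit -> has_width A d -> unsatisfiable A b ->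
  refutes (cnf_ineq (cnf lit A b))
    ((m * #|F| ^ d.+1) ^ (25 * trunc_log 2 m)).
Proof.
move=> m1 litP width unsat.
have q1 : (1 < #|F|)%N := card_finNzRing_gt1 F.
have [p [g [/andP [p1 pq] gD g_lt [x gx]]]] := residue_functional F.
have [y0 [y0A y0b]] := unsatisfiable_witness unsat.
(* Rescaled so that the combined right-hand side is [x], where [g] does not vanish. *)
pose y := (x / (y0 *m b) 0 0) *: y0.
pose U := \bigcup_i Defs.support A i.
have supportU i : Defs.support A i \subset U by apply: bigcup_sup.
have rowE : comb_row A y (enum 'I_m) = 0.
  by rewrite /comb_row big_enum -mulmx_sum_row /y -scalemxAl y0A scaler0.
have rhsE : comb_rhs b y (enum 'I_m) = x.
  have -> : comb_rhs b y (enum 'I_m) = (y *m b) 0 0.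
    by rewrite mxE /comb_rhs big_enum.
  by rewrite /y -scalemxAl mxE divfK.
set H := cnf_ineq _.
have [i bi] := unsatisfiable_rhs unsat.
have h0P : exists h, H h.
  exists (\sum_(j in Defs.support A i)
    (one_form _ - val_form lit j ((0 : 'cV[F]_n) j 0)) - one_form _).
  by apply: equation_axiom; rewrite // mulmx0 mxE eq_sym.
have form0 : residue_form g lit (comb_row A y (enum 'I_m)) = 0.
  rewrite rowE /residue_form big1 // => j _; rewrite big1 // => u _.
  by rewrite mxE mul0r (residue0 gD g_lt).
have pn0 : ~~ (p%:Z %| (0 - (g (comb_rhs b y (enum 'I_m)))%:Z)%R)%Z.
  rewrite rhsE sub0r rpredN dvdzE /=.
  by apply: contraL gx => /dvdn_leq; move: (g_lt x); case: (g x) => // k; lia.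
have [h0 /derives_zero H0] := h0P.
set L := trunc_log 2 m.
have L0 : (0 < L)%N by rewrite /L trunc_log_gt0.
have szS : (size (enum 'I_m) <= 2 ^ L.+1)%N.
  by rewrite size_enum_ord ltnW // trunc_log_ltn.
have addH h : H h -> add_hyp H 0 h by left.
have main : refutes (add_hyp H 0) (iter L.+1
    (exhaust_size F U \o exhaust_size F U) (leaf_size F d)).
  apply: (refutes_system p1 gD g_lt litP pq supportU width addH h0P szS _ _
    pn0).
    by rewrite form0 mulr0z subr0; right.
  by rewrite form0 mulr0z subr0; right.
apply: derives_leq (derives_cut H0 main).
have cardU : (#|U| * #|F| <= m * d * #|F|)%N.
  by rewrite leq_mul2r -[m in (m * d)%N]card_ord card_bigcup_le ?orbT.
have leaf0 : (0 < leaf_size F d)%N by rewrite /leaf_size addnS.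
have /andP [_ iterP] := iter_exhaust_le L.+1 leaf0 (exhaust_size_ge F U)
  (fun s => exhaust_size_le m1 q1 cardU (s := s)).
have W4 := base_ge4 d m1 q1.
have leafP := leaf_size_le d m1 q1.
move: iterP leafP; rewrite -/(leaf_size F d) -expnM.
move: (leaf_size F d) leaf0 (iter _ _ _) (m * _)%N W4 => l l0 T W W4 TW lW.
(* There are 2 (L + 1) factors [W ^ 4] and a leaf of size at most [W ^ 8]. The two lines for 0 cost
   one more factor [W], and 8 L + 17 <= 25 L as L >= 1. *)
have {TW lW} TW : (T <= W ^ (8 * L + 16))%N.
  apply: leq_trans TW _; apply: leq_trans (leq_mul (leqnn _) lW) _.
  by rewrite -expnD leq_pexp2l ?(leq_trans _ W4) //; lia.
apply: (@leq_trans (W ^ (8 * L + 17))).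
  rewrite addnS expnS.
  have : (1 <= W ^ (8 * L + 16))%N by rewrite expn_gt0 (leq_trans _ W4).
  nia.
by rewrite leq_pexp2l ?(leq_trans _ W4) //; lia.
Qed.

(* With a single equation the bound is 1, and that equation is 0 = b. *)
Lemma refutes_single (F : finFieldType) (B : finType)
    (lit : F -> literal B) (n : nat) (A : 'M[F]_(1, n)) (b : 'cV[F]_1) :
  value_encoding lit -> unsatisfiable A b -> refutes (cnf_ineq (cnf lit A b)) 1.
Proof.
move=> litP unsat; have [i bi] := unsatisfiable_rhs unsat.
(* The equation could be solved for a variable with nonzero coefficient. *)
have supp0 j : j \notin Defs.support A i.
  rewrite inE negbK; apply/eqP/eqP; apply/negPn/negP => Aj; apply: unsat.
  exists (b i 0 / A i j *: delta_mx j 0); rewrite -scalemxAr -colE.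
  by apply/colP => k; rewrite !mxE !ord1 in Aj *; rewrite divfK.
apply: derives_hyp.
have := @equation_axiom _ _ lit _ _ A b litP i 0.
rewrite mulmx0 mxE eq_sym => /(_ bi); rewrite big1 ?sub0r // => j.
by rewrite (negPf (supp0 j)).
Qed.

(** For d >= 2, d + 1 <= 3 (d - 1) gives the constant 3 * 25 = 75. For d <= 1 the conventional size
    is just m, and the factor q^2 has to be absorbed by m^(2 q), so the constant depends on the
    field. *)
Theorem theorem1p3 :
  exists c : nat, forall F : finFieldType, exists c1 : nat,
  forall (B : finType) (lit : F -> literal B) (m n d : nat)
    (A : 'M[F]_(m, n)) (b : 'cV[F]_m),
  value_encoding lit ->
  has_width A d ->
  unsatisfiable A b ->
  exists pf : seq (ineq ('I_n * B)%type),
    cp_refutation (cnf_ineq (cnf lit A b)) pf /\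
    (size pf <= cnf_size F m d ^ ((if (d <= 1)%N then c1 else c) * trunc_log 2 m))%N.
Proof.
exists 75 => F; exists (25 * (1 + 2 * #|F|))%N.
move=> B lit m n d A b litP width unsat.
have q1 : (1 < #|F|)%N := card_finNzRing_gt1 F.
suff [pf [pfP szpf onepf]] : refutes (cnf_ineq (cnf lit A b))
    (cnf_size F m d ^ ((if (d <= 1)%N then 25 * (1 + 2 * #|F|) else 75) *
                        trunc_log 2 m)).
  exists pf; split=> //; split=> //; move: onepf; congr (_ \in pf).
  by apply/pair_eqP; rewrite /= oppr0 !eqxx.
have [m1|] := ltnP 1 m; last first.
  case: m A b width unsat => [|[|//]] A b _ unsat _.
    by case: unsat; exists 0; apply/colP => -[].
  by rewrite trunc_log1 muln0 expn0; apply: refutes_single.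
apply: derives_leq (refutes_unsatisfiable m1 litP width unsat).
have L0 : (0 < 25 * trunc_log 2 m)%N by rewrite muln_gt0 trunc_log_gt0.
rewrite /cnf_size; case: ifP => [d1|/negbT]; last rewrite -ltnNge => d1.
  have -> : d.-1 = 0%N by case: d d1 {width} => [|[]].
  rewrite expn0 muln1 [in leqRHS]mulnAC [in leqRHS]mulnC.
  rewrite [leqRHS]expnM leq_exp2r //.
  rewrite expnD expn1 leq_mul2l expnM; apply/orP; right.
  apply: (@leq_trans (#|F| ^ 2)); first by rewrite leq_pexp2l // ltnW.
  rewrite -expnM mulnC expnM leq_exp2r //.
  by apply: leq_trans (ltnW (ltn_expl #|F| m1)) _.
rewrite -[75]/(3 * 25)%N -[(3 * 25 * _)%N]mulnA [leqRHS]expnM leq_exp2r //.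
rewrite expnMn -expnM; apply: leq_mul.
  by rewrite -{1}[m]expn1 leq_pexp2l // ltnW.
by rewrite leq_pexp2l; lia.
Qed.
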